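(* Let $s\in\{0,\tfrac12\}$. There exist a faithful state $\rho$ on $\mathcal{A}=M_{3\times 3}(\mathbb{C})$ and a quantum Markov semigroup $(\mathcal{P}_t)_{t\ge 0}$ on $\mathcal{A}$ with generator $L$, such that every $\mathcal{P}_t$ is symmetric with respect to the GNS inner product $\langle\cdot,\cdot\rangle_0$ of $\rho$, for which there do not exist a Hilbert $\mathcal{A}$-$\mathcal{A}$ bimodule $H$ and a derivation $\delta:\mathcal{A}\to H$ with $L=\delta^*\circ\delta$, where $\delta$ is regarded as an operator from the Hilbert space $(\mathcal{A},\langle\cdot,\cdot\rangle_s)$ to $H$ and $\delta^*$ is its adjoint (equivalently, such that $\langle L(A),B\rangle_s=\langle\delta(A),\delta(B)\rangle_H$ for all $A,B\in\mathcal{A}$).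
   Context: Sesquilinear forms are linear in the first and antilinear in the second coordinate. Inner products: for a faithful state $\rho$ on $M_{n\times n}(\mathbb{C})$ with density matrix $d_\rho$ with respect to the normalised trace $\tau$ (so $\rho(A)=\tau(d_\rho A)$), the modular automorphism group is $\sigma_t^\rho(A)=d_\rho^{it}Ad_\rho^{-it}$ for $t\in\mathbb{C}$. For $s\in[0,1]$ put $\langle A,B\rangle_s=\rho(\sigma^\rho_{si}(B^* )A)=\tau(d_\rho^{1-s}B^*d_\rho^{s}A)$. $\langle\cdot,\cdot\rangle_0$ is the GNS inner product, $\langle\cdot,\cdot\rangle_{1/2}$ the KMS inner product. Quantum Markov semigroup (QMS) on a unital C*-algebra $\mathcal{A}$: a strongly continuous one-parameter semigroup $(\mathcal{P}_t)_{t\ge0}$ of bounded linear maps on $\mathcal{A}$ with every $\mathcal{P}_t$ completely positive and $\mathcal{P}_t(1)=1$. Its generator is the operator $L$ with $\mathcal{P}_t=e^{-tL}$. Bimodules: an $\mathcal{A}$-$\mathcal{A}$ bimodule is a complex vector space $H$ with algebra homomorphisms $L$ and $R$ from $\mathcal{A}$ and the opposite algebra $\mathcal{A}^\circ$, respectively, to the linear maps on $H$ such that $L(\mathcal{A})$ and $R(\mathcal{A})$ commute (actions are not assumed unital); write $Ax=L(A)x$, $xA=R(A)x$. For a $*$-algebra $\mathcal{A}$, an $\mathcal{A}$-$\mathcal{A}$ $*$-bimodule is such a bimodule with a positive (semidefinite) sesquilinear form such that $\langle Ax,y\rangle=\langle x,A^*y\rangle$, $\langle xA,y\rangle=\langle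 x,yA^*\rangle$ for all $x,y\in H$, $A\in\mathcal{A}$, and all $L(A)$, $R(A)$ are bounded. If $H$ is a Hilbert space with this form, it is called a Hilbert $\mathcal{A}$-$\mathcal{A}$ bimodule. Derivation: a linear map $\delta:\mathcal{A}\to H$ with $\delta(AB)=A\delta(B)+\delta(A)B$ for all $A,B\in\mathcal{A}$. *)

(* Defs.v *)
From HB Require Import structures.
From mathcomp Require Import all_boot all_order all_algebra.
From mathcomp Require Import all_classical all_reals all_analysis.
From mathcomp Require Import complex.

Set Implicit Arguments.
Unset Strict Implicit.
Unset Printing Implicit Defensive.

Import Order.TTheory GRing.Theory Num.Theory numFieldNormedType.Exports.

Local Open Scope classical_set_scope.
Local Open Scope ring_scope.
Local Open Scope complex_scope.
Local Open Scope sesquilinear_scope.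

(* The size is written n.+1, so that 'M_n.+1 is a nonzero algebra and a normed
   space; its norm, the maximum modulus of the entries, is equivalent to the
   C*-norm. [A ^t*] is the conjugate transpose of A. *)

Section States.
Variables (R : realType) (n : nat).
Local Notation C := R[i].
Local Notation A := 'M[C]_n.+1.

Definition normalized_trace (a : A) : C := \tr a / n.+1%:R.

Record faithful_state (rho : {scalar A}) : Prop := FaithfulState {
  state_ge0 : forall a : A, 0 <= rho (a ^t* *m a);
  state1 : rho 1 = 1;
  state_faithful : forall a : A, rho (a ^t* *m a) = 0 -> a = 0 }.

(* The density matrix with respect to the normalized trace; see densityE. *)
Definition density (rho : {scalar A}) : A :=
  \matrix_(i, j) (n.+1%:R * rho (delta_mx j i)).

Lemma densityE (rho : {scalar A}) (a : A) :
  rho a = normalized_trace (density rho *m a).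
Proof.
rewrite {1}(matrix_sum_delta a) linear_sum /normalized_trace /mxtrace mulr_suml.
under eq_bigr do rewrite linear_sum.
rewrite exchange_big /=; apply: eq_bigr => j _.
rewrite mxE mulr_suml; apply: eq_bigr => i _.
by rewrite linearZ /= mxE mulrAC [_%:R * _]mulrC mulfK ?pnatr_eq0 // mulrC.
Qed.

(* d^r by functional calculus, for d positive definite (so that d is normal
   and its eigenvalues are positive reals) and r real. *)
Definition mxpow (d : A) (r : R) : A :=
  invmx (spectralmx d)
  *m diag_mx (map_mx (fun z : C => (complex.Re z `^ r)%:C) (spectral_diag d))
  *m spectralmx d.

(* <a, b>_s; s = 0 is the GNS inner product, s = 1/2 the KMS one. *)
Definition state_ip (rho : {scalar A}) (s : R) (a b : A) : C :=
  normalized_trace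
    (mxpow (density rho) (1 - s) *m b ^t* *m mxpow (density rho) s *m a).

Definition symmetric_wrt (ip : A -> A -> C) (T : A -> A) : Prop :=
  forall a b : A, ip (T a) b = ip a (T b).

End States.

Section MarkovSemigroups.
Variables (R : realType) (n : nat).
Local Notation C := R[i].
Local Notation A := 'M[C]_n.+1.
(* A with its normed space structure, which is not inferred from the type. *)
Local Notation normedA := (A : normedModType C).

(* Positivity in M_k(A), seen as an operator on (C^(n+1))^k. *)
Definition block_positive (k : nat) (X : 'M[A]_k) : Prop :=
  forall v : 'I_k -> 'cV[C]_n.+1,
    0 <= \sum_i \sum_j ((v i) ^t* *m X i j *m v j) 0 0.

Definition completely_positive (T : A -> A) : Prop :=
  forall (k : nat) (X : 'M[A]_k),
    block_positive X -> block_positive (map_mx T X).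

(* The values of P at negative times are irrelevant. *)
Record quantum_markov_semigroup (P : R -> A -> A) : Prop :=
  QuantumMarkovSemigroup {
    qms_linear : forall t : R, 0 <= t -> linear (P t);
    qms_bounded : forall t : R, 0 <= t -> continuous (P t : normedA -> normedA);
    qms_0 : forall a : A, P 0 a = a;
    qms_add : forall t u : R, 0 <= t -> 0 <= u ->
      forall a : A, P (t + u) a = P t (P u a);
    qms_strongly_continuous : forall a : A,
      {within `[0, +oo[, continuous (fun t : R => P t a : normedA)};
    qms_completely_positive : forall t : R, 0 <= t -> completely_positive (P t);
    qms_unital : forall t : R, 0 <= t -> P t 1 = 1 }.

(* P_t = e^{-tL}, with this sign convention. *)
Definition is_generator (P : R -> A -> A) (L : {linear A -> A}) : Prop :=
  forall (t : R) (a : A), 0 <= t ->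
    [series ((- t) ^+ k / k`!%:R)%:C *: iter k L a]_k @ \oo
      --> (P t a : normedA).

End MarkovSemigroups.

Section Bimodules.
Variables (R : realType) (n : nat).
Local Notation C := R[i].
Local Notation A := 'M[C]_n.+1.

(* The actions need not be unital. The form is linear in its first argument
   and antilinear in the second one. *)
Record hilbert_bimodule := HilbertBimodule {
  hb_space :> completeNormedModType C;
  hb_ip : {dot hb_space for Num.conj};
  hb_norm : forall x, hb_ip x x = `|x| ^+ 2;
  hb_left : {bilinear A -> hb_space -> hb_space};
  hb_right : {bilinear A -> hb_space -> hb_space};
  hb_leftM : forall a b x, hb_left (a *m b) x = hb_left a (hb_left b x);
  hb_rightM : forall a b x, hb_right (a *m b) x = hb_right b (hb_right a x);
  hb_commute : forall a b x,
    hb_left a (hb_right b x) = hb_right b (hb_left a x);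
  hb_left_adjoint : forall a x y,
    hb_ip (hb_left a x) y = hb_ip x (hb_left (a ^t*) y);
  hb_right_adjoint : forall a x y,
    hb_ip (hb_right a x) y = hb_ip x (hb_right (a ^t*) y);
  hb_left_bounded : forall a, exists M : R,
    forall x, `|hb_left a x| <= M%:C * `|x|;
  hb_right_bounded : forall a, exists M : R,
    forall x, `|hb_right a x| <= M%:C * `|x| }.

Definition derivation (H : hilbert_bimodule) (delta : {linear A -> H}) : Prop :=
  forall a b : A,
    delta (a *m b) = hb_left H a (delta b) + hb_right H b (delta a).

(* T is the adjoint of delta, with A carrying the inner product ip. *)
Definition is_adjoint (ip : A -> A -> C) (H : hilbert_bimodule)
    (delta : {linear A -> H}) (T : {linear H -> A}) : Prop :=
  forall (a : A) (x : H), hb_ip H (delta a) x = ip a (T x).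

End Bimodules.

(* Main.v *)
Require Import Defs.
From HB Require Import structures.
From mathcomp Require Import all_boot all_order all_algebra.
From mathcomp Require Import all_classical all_reals all_analysis.
From mathcomp Require Import complex.
From mathcomp Require Import ring lra.

Import Order.TTheory GRing.Theory Num.Theory numFieldNormedType.Exports.

Local Open Scope ring_scope.
Local Open Scope complex_scope.
Local Open Scope sesquilinear_scope.
Local Open Scope classical_set_scope.

(** * Why a dephasing semigroup is not a square

    Let p be the projection onto the first basis vector, q = 1 - p, and
    E (a) = p a p + q a q.  The dephasing semigroup
    P_t = e^(-t) id + (1 - e^(-t)) E multiplies the off-diagonal blocks by
    e^(-t).  Its generator is the idempotent L = id - E ([offblock]); with the
    unitary u = p - q one has E (a) = (a + u a u) / 2, so P_t is a convex
    combination of the identity and of conjugation by u, hence completely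
    positive.  P_t multiplies each matrix entry by a real number, so it is
    symmetric for the inner products <.,.>_s of every diagonal state.

    Suppose L = delta^* delta for a derivation delta.  As L vanishes on q A q,
    so does delta, because |delta (a)|^2 = <a, L (a)>_s.  For two indices j, k
    other than 0, the product rule applied to e_0j = e_0k e_kj gives
    delta (e_0j) = delta (e_0k) e_kj, and symmetrically in j and k.  Since the
    right action is a *-representation, |delta (e_0j)| = |delta (e_0k)|
    ([derivation_delta_norm]).  But L fixes e_0j, so |delta (e_0j)|^2 is
    |e_0j|_s^2, which is proportional to d_j^(1-s) for a diagonal density
    matrix d ([state_ip_delta]).  For s < 1 a state with d_j <> d_k excludes
    such a delta ([offblock_not_square]); in dimension 3 there is room for
    j = 1 and k = 2. *)

Set Implicit Arguments.
Unset Strict Implicit.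

(** * Continuity *)

Section RealComplex.
Variable R : realType.

Lemma normc_real (x : R) : `|x%:C| = `|x|%:C.
Proof. by rewrite normc_def /= expr0n addr0 sqrtr_sqr. Qed.

Lemma real_complex_continuous :
  continuous (fun x : R => x%:C : (R[i] : numFieldType)).
Proof.
move=> x; apply/cvgrPdist_lt => e e0.
have eE : (complex.Re e)%:C = e by apply/RRe_real/gtr0_real.
have e1 : 0 < complex.Re e by rewrite -ltcR eE.
near=> y; rewrite -rmorphB normc_real -eE ltcR.
by near: y; move: (complex.Re e) e1; apply/cvgrPdist_lt; exact: cvg_id.
Unshelve. all: by end_near. Qed.

End RealComplex.

Lemma continuous_subZ (K : numFieldType) (V : normedModType K) (f : V -> V)
  (c : K) : continuous f -> continuous (fun x => x - c *: f x).
Proof.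
by move=> fc x; apply: cvgB; [exact: cvg_id | apply: cvgZl_tmp; exact: fc].
Qed.

(** * Diagonal states and their inner products *)

Section DiagonalState.
Variables (R : realType) (n : nat).
Local Notation C := R[i].
Local Notation A := 'M[C]_n.+1.

(** A unitary diagonalising a diagonal matrix only links indices with equal
    diagonal entries, so the functional calculus acts entrywise whatever
    diagonalisation is chosen. *)
Lemma mxpow_diag (d : 'rV[R]_n.+1) (r : R) :
  mxpow (diag_mx (map_mx (fun x => x%:C) d)) r =
  diag_mx (map_mx (fun x => (x `^ r)%:C) d).
Proof.
rewrite /mxpow; set D := diag_mx _; set P := spectralmx D.
have Pu : P \in unitmx by exact: spectral_unit.
have nD : D \is normalmx.
  apply/normalmxP; rewrite /D tr_diag_mx map_diag_mx; exact: diag_mxC.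
have PD : P *m D = diag_mx (spectral_diag D) *m P.
  by rewrite {1}((orthomx_spectralP) nD) !mulmxA mulmxV // mul1mx.
rewrite -mulmxA -[RHS](mulKmx Pu); congr (_ *m _).
apply/matrixP => i j; rewrite mul_mx_diag mul_diag_mx !mxE.
have /matrixP/(_ i j) := PD; rewrite mul_mx_diag mul_diag_mx !mxE.
have [->|Pij] := eqVneq (P i j) 0; first by rewrite !(mulr0, mul0r).
by rewrite mulrC => /(mulIf Pij) <-; rewrite mulrC.
Qed.

Definition diag_state (w : 'I_n.+1 -> R) (a : A) : C :=
  \sum_i (w i)%:C * a i i.

Lemma diag_state_scalar w : scalar (diag_state w).
Proof.
move=> c a b; rewrite /diag_state mulr_sumr -big_split; apply: eq_bigr => i _.
by rewrite !mxE mulrDr mulrCA.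
Qed.

HB.instance Definition _ w :=
  GRing.isLinear.Build C A C _ (diag_state w) (diag_state_scalar w).

Lemma density_diag_state w :
  density (diag_state w) =
  diag_mx (map_mx (fun x => x%:C) (\row_i (n.+1%:R * w i))).
Proof.
apply/matrixP => i j; rewrite !mxE /= /diag_state.
rewrite (bigD1 j) //= big1 => [|k kj]; last first.
  by rewrite mxE (negPf kj) mulr0.
rewrite mxE eqxx addr0 /= rmorphM rmorph_nat [j == i]eq_sym.
by case: eqVneq => [->|_]; rewrite ?mulr1 ?mulr0 ?mulr0n ?mulr1n.
Qed.

Lemma state_ip_diag w s a b :
  state_ip (diag_state w) s a b =
  (\sum_i \sum_j
     ((n.+1%:R * w i) `^ (1 - s) * (n.+1%:R * w j) `^ s)%:C
       * ((b j i)^*%R * a j i)) / n.+1%:R.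
Proof.
rewrite /state_ip density_diag_state !mxpow_diag /normalized_trace.
congr (_ / _).
apply: eq_bigr => i _; rewrite mul_diag_mx mul_mx_diag !mxE.
by apply: eq_bigr => j _; rewrite !mxE rmorphM; ring.
Qed.

Lemma state_ip_delta w s i j :
  state_ip (diag_state w) s (delta_mx i j) (delta_mx i j) =
  ((n.+1%:R * w j) `^ (1 - s) * (n.+1%:R * w i) `^ s)%:C / n.+1%:R.
Proof.
rewrite state_ip_diag (bigD1 j) //= (bigD1 i) //= !mxE !eqxx conjC1 !mulr1.
rewrite big1 => [|k ki]; last by rewrite !mxE (negPf ki) /= mulr0 mulr0.
rewrite addr0 big1 ?addr0 // => k kj; apply: big1 => l _.
by rewrite !mxE (negPf kj) andbF mulr0 mulr0.
Qed.

Lemma diag_state_faithful w : (forall i, 0 < w i) -> \sum_i w i = 1 ->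
  faithful_state (diag_state w).
Proof.
move=> w0 w1.
have E (a : A) : diag_state w (a ^t* *m a) =
    \sum_i \sum_j (w i)%:C * `|a j i| ^+ 2.
  apply: eq_bigr => i _; rewrite mxE mulr_sumr; apply: eq_bigr => j _.
  by rewrite !mxE normCK; ring.
have ge (a : A) i j : 0 <= (w i)%:C * `|a j i| ^+ 2.
  by rewrite mulr_ge0 ?exprn_ge0 // ler0c ltW.
split => [a||a] /=.
- by rewrite E; apply: sumr_ge0 => i _; apply: sumr_ge0.
- rewrite /diag_state -[RHS](rmorph1 (real_complex R)) -w1 rmorph_sum.
  by apply: eq_bigr => i _; rewrite mxE eqxx mulr1.
rewrite E => a0; apply/matrixP => j i; rewrite mxE.
have s0 k : 0 <= \sum_l (w k)%:C * `|a l k| ^+ 2 by apply: sumr_ge0.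
have := psumr_eq0P (fun k _ => s0 k) a0 (i := i) isT.
move=> /(psumr_eq0P (fun l _ => ge a i l)) /(_ j isT) /eqP.
rewrite mulf_eq0 expf_eq0 normr_eq0 /=.
by have /negPf -> : (w i)%:C != 0; [rewrite gt_eqF // ltcR | move/eqP].
Qed.

End DiagonalState.

(** * The dephasing semigroup *)

Section Dephasing.
Variables (R : realType) (n : nat).
Local Notation C := R[i].
Local Notation A := 'M[C]_n.+1.
Local Notation normedA := (A : normedModType C).

(** This is a - E (a); the entries that survive are those in the row or the
    column of index 0 but not on the diagonal. *)
Definition offblock (a : A) : A :=
  \matrix_(i, j) (if (i == 0) == (j == 0) then 0 else a i j).

Lemma offblock_linear : linear offblock.
Proof.
move=> c a b; apply/matrixP => i j; rewrite !mxE.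
by case: ifP => _; rewrite ?mulr0 ?addr0.
Qed.

HB.instance Definition _ :=
  GRing.isLinear.Build C A A _ offblock offblock_linear.

Lemma offblock_idem a : offblock (offblock a) = offblock a.
Proof. by apply/matrixP => i j; rewrite !mxE; case: ifP => // ->. Qed.

Lemma offblock1 : offblock 1 = 0.
Proof.
apply/matrixP => i j; rewrite !mxE.
by case: (eqVneq i j) => [->|_]; rewrite ?eqxx ?if_same.
Qed.

Lemma offblock_continuous : continuous (offblock : normedA -> normedA).
Proof.
move=> a s /= /(nbhs_ballP (offblock a : normedA)) [e e0 es].
apply/(nbhs_ballP (a : normedA)); exists e => //= b [_ ab].
apply: es; split => // i j.
by rewrite !mxE; case: ifP => _; [exact: ballxx | exact: ab].
Qed.

(** The unitary u = p - q. *)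
Definition block_sign : A := diag_mx (\row_i (if i == 0 then 1 else -1)).

Lemma offblockE a : offblock a = 2^-1 *: (a - block_sign *m a *m block_sign).
Proof.
apply/matrixP => i j; rewrite /block_sign mul_diag_mx mul_mx_diag !mxE.
by case: (i == 0); case: (j == 0) => /=; field.
Qed.

Lemma block_sign_adj : block_sign ^t* = block_sign.
Proof.
apply/matrixP => i j; rewrite !mxE [i == j]eq_sym.
case: (eqVneq j i) => [->|_].
  by case: ifP => _; rewrite mulr1n ?rmorphN /= conjC1.
by rewrite !mulr0n conjC0.
Qed.

Definition dephasing (t : R) (a : A) : A :=
  a - (1 - expR (- t))%:C *: offblock a.

Lemma dephasing_linear t : linear (dephasing t).
Proof.
move=> c a b; rewrite /dephasing linearP; apply/matrixP => i j.
by rewrite !mxE; ring.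
Qed.

(** Both coefficients are nonnegative for t >= 0, which gives complete
    positivity. *)
Lemma dephasing_avg t a : dephasing t a =
  ((1 + expR (- t)) / 2)%:C *: a
  + ((1 - expR (- t)) / 2)%:C *: (block_sign *m a *m block_sign).
Proof.
rewrite /dephasing offblockE; apply/matrixP => i j; rewrite !mxE.
by rewrite !rmorphM !rmorphD rmorphN rmorph1 fmorphV rmorph_nat; field.
Qed.

Lemma dephasing_cp t : 0 <= t -> completely_positive (dephasing t).
Proof.
move=> t0 k X X0 v.
have e1 : expR (- t) <= 1 by rewrite -expR0 ler_expR oppr_le0.
have e0 := expR_ge0 (- t).
pose q (u : 'I_k -> 'cV[C]_n.+1) :=
  \sum_i \sum_j ((u i) ^t* *m X i j *m u j) 0 0.
suff -> : \sum_i \sum_j ((v i) ^t* *m map_mx (dephasing t) X i j *m v j) 0 0 =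
    ((1 + expR (- t)) / 2)%:C * q v
    + ((1 - expR (- t)) / 2)%:C * q (fun i => block_sign *m v i).
  by rewrite addr_ge0 // mulr_ge0 ?X0 // ler0c; lra.
rewrite /q !mulr_sumr -big_split; apply: eq_bigr => i _ /=.
rewrite !mulr_sumr -big_split; apply: eq_bigr => j _ /=.
rewrite [map_mx _ X i j]mxE dephasing_avg mulmxDr mulmxDl.
rewrite -!scalemxAr -!scalemxAl.
by rewrite trmx_mul map_mxM /= block_sign_adj !mulmxA !mxE.
Qed.

Lemma dephasing_qms : quantum_markov_semigroup dephasing.
Proof.
split => [t _|t _|a|t u _ _ a|a|t t0|t _].
- exact: dephasing_linear.
- exact/(@continuous_subZ _ normedA)/offblock_continuous.
- by rewrite /dephasing oppr0 expR0 subrr scale0r subr0.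
- rewrite /dephasing [offblock (_ - _)]linearB /=.
  rewrite [offblock (_ *: _)]linearZ /= offblock_idem.
  apply/matrixP => i j; rewrite !mxE opprD expRD.
  by rewrite !rmorphB !rmorph1 rmorphM; ring.
- apply: continuous_subspaceT => t; apply: (@cvgB _ normedA).
    exact: cvg_cst.
  apply: (@cvgZr_tmp _ normedA).
  apply: (@continuous_comp _ _ _ (fun u : R => 1 - expR (- u))).
    apply: cvgB; first exact: cvg_cst.
    apply: continuous_comp; [exact: opp_continuous | exact: continuous_expR].
  exact: real_complex_continuous.
- exact: dephasing_cp.
by rewrite /dephasing offblock1 scaler0 subr0.
Qed.

(** As [offblock] is idempotent, the exponential series collapses to
    id - L + e^(-t) L. *)
Lemma dephasing_generator : is_generator dephasing offblock.
Proof.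
move=> t a _.
(* The term k = 0 is the identity and not L: it is split off below. *)
have it k : iter k.+1 offblock a = offblock a.
  by elim: k => // k IH; rewrite iterS IH offblock_idem.
have -> : dephasing t a = a - offblock a + (expR (- t))%:C *: offblock a.
  by rewrite /dephasing rmorphB rmorph1 scalerBl scale1r opprB addrA addrAC.
rewrite -(cvg_shiftS (series _)).
have -> :
    (fun m => [series ((- t) ^+ k / k`!%:R)%:C *: iter k offblock a]_k m.+1) =
    (fun m => a - offblock a
              + (series (exp_coeff (- t)) m.+1)%:C *: offblock a).
  apply/funext => m; rewrite /series /= !big_nat_recl //= expr0 fact0 divr1.
  rewrite rmorph1 scale1r rmorphD /= {1}/exp_coeff /= expr0 fact0 divr1.
  rewrite rmorph1 scalerDl scale1r addrA subrK; congr (_ + _).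
  rewrite rmorph_sum scaler_suml; apply: eq_bigr => k _.
  by rewrite -iterS it.
apply: (@cvgD _ normedA); first exact: cvg_cst.
apply: (@cvgZr_tmp _ normedA); apply: continuous_cvg.
  exact: real_complex_continuous.
rewrite (cvg_shiftS (series (exp_coeff (- t)))).
exact: is_cvg_series_exp_coeff.
Qed.

Lemma dephasing_symmetric (w : 'I_n.+1 -> R) (s t : R) :
  symmetric_wrt (state_ip (diag_state w) s) (dephasing t).
Proof.
move=> a b; rewrite !state_ip_diag; congr (_ / _).
apply: eq_bigr => i _; apply: eq_bigr => j _; congr (_ * _); rewrite !mxE.
case: ifP => _; first by rewrite !mulr0 !subr0.
set c := _%:C; have cr : c^*%R = c.
  by apply/CrealP/complex_realP; exists (1 - expR (- t)).
by rewrite [(b j i - _)^*%R]rmorphB rmorphM /= cr; ring.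
Qed.

End Dephasing.

(** * The obstruction *)

Section Obstruction.
Variables (R : realType) (n : nat).

(** The product rule for e_ij = e_ik e_kj reduces to
    delta (e_ij) = delta (e_ik) e_kj, and likewise with j and k exchanged; the
    adjoint of right multiplication by e_kj is right multiplication by e_jk. *)
Lemma derivation_delta_norm (H : hilbert_bimodule R n)
    (delta : {linear 'M[R[i]]_n.+1 -> H}) (i j k : 'I_n.+1) :
  derivation delta -> delta (delta_mx j k) = 0 -> delta (delta_mx k j) = 0 ->
  hb_ip H (delta (delta_mx i j)) (delta (delta_mx i j)) =
  hb_ip H (delta (delta_mx i k)) (delta (delta_mx i k)).
Proof.
move=> der jk kj.
have right (l m : 'I_n.+1) : delta (delta_mx l m) = 0 ->
    hb_right H (delta_mx l m) (delta (delta_mx i l)) = delta (delta_mx i m).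
  by move=> lm; rewrite -[in RHS](mul_delta_mx l) der lm linear0r add0r.
rewrite -{1}(right k j kj) hb_right_adjoint.
have -> : (delta_mx k j : 'M[R[i]]_n.+1) ^t* = delta_mx j k.
  by rewrite trmx_delta map_delta_mx.
by rewrite right.
Qed.

(** The indices j and k lie in one block, on which delta must vanish, while the
    norms of e_0j and e_0k, both fixed by [offblock], differ. *)
Lemma offblock_not_square (w : 'I_n.+1 -> R) (s : R) (j k : 'I_n.+1) :
  (forall i, 0 < w i) -> s < 1 -> j != 0 -> k != 0 -> w j != w k ->
  ~ exists (H : hilbert_bimodule R n)
           (delta : {linear 'M[R[i]]_n.+1 -> H})
           (delta_adj : {linear H -> 'M[R[i]]_n.+1}),
      [/\ derivation delta,
          is_adjoint (state_ip (diag_state w) s) delta delta_adj &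
          forall a, offblock a = delta_adj (delta a)].
Proof.
move=> w0 s1 j0 k0 wjk [H [delta [T [der adj fact]]]].
have ipE a : hb_ip H (delta a) (delta a) =
    state_ip (diag_state w) s a (offblock a).
  by rewrite adj fact.
have ker l m : l != 0 -> m != 0 -> delta (delta_mx l m) = 0.
  move=> l0 m0; apply/eqP; rewrite -normr_eq0 -sqrf_eq0 -hb_norm ipE.
  have -> : offblock (delta_mx l m : 'M[R[i]]_n.+1) = 0.
    apply/matrixP => i i'; rewrite !mxE; case: eqP => // ii'.
    apply/eqP; rewrite pnatr_eq0 eqb0; apply/negP => /andP[/eqP il /eqP im].
    by case: ii'; rewrite il im (negPf l0) (negPf m0).
  rewrite state_ip_diag big1 ?mul0r // => i _; rewrite big1 // => i' _.
  by rewrite mxE conjC0 mul0r mulr0.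
have off m : m != 0 -> offblock (delta_mx 0 m : 'M[R[i]]_n.+1) = delta_mx 0 m.
  move=> m0; apply/matrixP => i i'; rewrite !mxE; case: eqP => // ii'.
  apply/esym/eqP; rewrite pnatr_eq0 eqb0; apply/negP => /andP[/eqP i0 /eqP im].
  by move: ii'; rewrite i0 im eqxx (negPf m0).
have := derivation_delta_norm 0 der (ker j k j0 k0) (ker k j k0 j0).
rewrite !ipE !off // !state_ip_delta.
have n0 : n.+1%:R^-1 != 0 :> R[i] by rewrite invr_eq0 pnatr_eq0.
move=> /(mulIf n0) /complexI.
have p0 : (n.+1%:R * w 0) `^ s != 0 by rewrite gt_eqF // powR_gt0 // mulr_gt0.
move=> /(mulIf p0) /(@powR_injective _ (1 - s)).
rewrite subr_gt0 => /(_ s1) E.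
case/eqP: wjk; apply: (@mulfI _ n.+1%:R); first by rewrite pnatr_eq0.
by apply: E; rewrite nnegrE ltW // mulr_gt0.
Qed.

End Obstruction.

Unset Implicit Arguments.
Set Strict Implicit.

Theorem mainTheorem1 (R : realType) (s : R) (hs : s = 0 \/ s = 2^-1) :
  exists (rho : {scalar 'M[R[i]]_3})
         (P : R -> 'M[R[i]]_3 -> 'M[R[i]]_3)
         (L : {linear 'M[R[i]]_3 -> 'M[R[i]]_3}),
    [/\ faithful_state rho,
        quantum_markov_semigroup P,
        is_generator P L,
        (forall t : R, 0 <= t -> symmetric_wrt (state_ip rho 0) (P t)) &
        ~ exists (H : hilbert_bimodule R 2)
                 (delta : {linear 'M[R[i]]_3 -> H})
                 (delta_adj : {linear H -> 'M[R[i]]_3}),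
            [/\ derivation delta,
                is_adjoint (state_ip rho s) delta delta_adj &
                forall a : 'M[R[i]]_3, L a = delta_adj (delta a)]].
Proof.
(* What the obstruction needs is that w 1 and w 2 differ. *)
pose w (i : 'I_3) : R := if i == ord_max then 2^-1 else 4^-1.
have w0 i : 0 < w i by rewrite /w; case: ifP => _; rewrite invr_gt0.
exists (diag_state w), (@dephasing R 2), (@offblock R 2); split.
- apply: diag_state_faithful => //.
  by rewrite !big_ord_recr big_ord0 /w /=; field.
- exact: dephasing_qms.
- exact: dephasing_generator.
- by move=> t _; exact: dephasing_symmetric.
apply: (@offblock_not_square R 2 w s 1 ord_max) => //.
  by case: hs => ->; lra.
by rewrite /w /=; lra.
Qed.
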